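(* Let $G$ be a soluble CPPO-group, that is, a finite soluble group such that for all $x,y\in G$ the order of the commutator $[x,y]=x^{-1}y^{-1}xy$ is a prime power. Then the order of the commutator subgroup $G'$ is divisible by at most two primes, i.e. the set of prime divisors of $|G'|$ has at most two elements.
   Context: A CPPO-group is a finite group in which every commutator $[x,y]=x^{-1}y^{-1}xy$ (with $x,y$ in the group) has prime power order, i.e. order $p^k$ for some prime $p$ and integer $k\ge 0$; the prime may depend on the commutator, and the identity element (order $1$) is regarded as having prime power order. $G'$ denotes the commutator (derived) subgroup of $G$, that is, the subgroup generated by all commutators $[x,y]$ with $x,y\in G$. *)

(* Defs.v *)
From mathcomp Require Import all_boot all_fingroup all_solvable.

Set Implicit Arguments.
Unset Strict Implicit.
Unset Printing Implicit Defensive.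

Local Open Scope group_scope.

(* The identity qualifies, with k = 0. *)
Definition prime_power_order (gT : finGroupType) (z : gT) : Prop :=
  exists p k : nat, prime p /\ #[z] = (p ^ k)%N.

(* [~ x, y] is x^-1 * (y^-1 * (x * y)), by definition of commg and conjg. *)
Definition CPPO_group (gT : finGroupType) (G : {group gT}) : Prop :=
  forall x y : gT, x \in G -> y \in G -> prime_power_order [~ x, y].

(* Main.v *)
Require Import Defs.
From mathcomp Require Import all_boot all_fingroup all_solvable.
From mathcomp Require Import mxrepresentation mxabelem.

Set Implicit Arguments.
Unset Strict Implicit.
Unset Printing Implicit Defensive.

Local Open Scope group_scope.

(** Why at most two primes divide the order of G'.

The engine is one observation, [CPPO_commg_sub].  Let N be a normal p-subgroup
of a CPPO-group G and let c = [a, b] be a nontrivial commutator of order prime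
to p.  Multiplying a^-1 by elements n of N produces, up to conjugation, the
commutators [n, b] c^-1, and modulo [N, c] the two factors commute and have
coprime orders; hence [n, b] lies in [N, c].  So a commutator moves at least as
much of N as each of its two entries does.

Take G a counterexample of least order and V a minimal normal subgroup of G
inside G', a p-group.  Minimality leaves exactly two primes q, r in |G'/V|, both
different from p, and a Frattini argument gives G = V H with V and H meeting
trivially (otherwise V and a p-complement of G' would be normal Hall subgroups
of G', and some commutator would lie in neither of them).  The derived subgroup
of H is a {q, r}-group that is not nilpotent, and this forces, up to exchanging
q and r, a commutator x = [a, b] of H of order prime to q acting nontrivially on
Q = O_q(H') ([CPPO_two_primes_action]).

Choose N <= Q minimal among the subgroups normalised by a and b and not
centralised by x.  Then N = [N, x], and by the engine a and b centralise
every proper subgroup of N that they normalise.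

If N were nonabelian it would have class 2, with Z = Z(N) centralised by a, b
and x.  All the commutators [a t, b s], for t, s in N, lie in x N, and those in
x Z must equal x, since an element x z with z <> 1 in Z has mixed order.
Modulo Z, the condition [a t, b s] in x Z is linear in (t, s); its solution
space S is the space of cocycles on the free group on a, b with values in N/Z
that vanish on x = [a, b], and polarising the identity [a t, b s] = x on S
yields the bilinear form given by the cup product on a torus with one boundary
component.  As x has no fixed point on N/Z, Poincare-Lefschetz duality makes
this form nondegenerate on S, while dim S >= dim N/Z > 0; so it cannot vanish.
An elementary form of this argument is [class2_abelian_of_CPPO].

If N is abelian, every c <> 1 in N is a commutator [y, x] with y in N, and the
engine applied to V gives [V, x] <= [V, c], whence [V, N] <= [V, c].  So N acts
fixed-point-freely on [V, N] and, unless [V, N] = 1, is cyclic; but then its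
automorphisms commute and x = [a, b] centralises it, which is absurd.  Finally,
if [V, N] = 1 then the engine on V gives [V, H] = 1, hence V <= G' <= H,
although V and H meet trivially. *)

(** * Finite groups *)

Lemma p_elt_mul_commute_eq1 (gT : finGroupType) (p q : nat) (u v : gT) :
  p.-elt u -> p^'.-elt v -> commute u v -> q.-elt (u * v) -> u = 1 \/ v = 1.
Proof.
move=> pu p'v cuv quv.
have u_p : (u * v).`_p = u.
  by rewrite consttM // (constt_p_elt pu) (constt1P p'v) mulg1.
have v_p': (u * v).`_p^' = v.
  by rewrite consttM // (constt_p_elt p'v) (constt1P _) ?mul1g ?p_eltNK.
have [eqpq | neqpq] := eqVneq p q.
  by right; rewrite -v_p'; apply/constt1P; rewrite p_eltNK eqpq.
left; rewrite -u_p; apply/constt1P.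
by apply: sub_p_elt quv => s; rewrite !inE => /eqP->; rewrite eq_sym.
Qed.

Lemma not_sub_two_groups (gT : finGroupType) (G H K : {group gT}) :
    ~~ (G \subset H) -> ~~ (G \subset K) ->
  exists2 x, x \in G & (x \notin H) && (x \notin K).
Proof.
case/subsetPn=> x Gx H'x /subsetPn[y Gy K'y].
have [Kx | K'x] := boolP (x \in K); last by exists x; rewrite ?H'x.
have [Hy | H'y] := boolP (y \in H); last by exists y; rewrite ?H'y.
by exists (x * y); [apply: groupM | rewrite groupMr // H'x groupMl].
Qed.

(** Let C be the centraliser of F = 'F(G) in G.  If the term n.+1 of the derived
series of C lies in F, it is centralised by C, so the term n has class at most 2
and lies in F as well; descend to n = 0. *)
Lemma cent_sub_Fitting (gT : finGroupType) (G : {group gT}) :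
  solvable G -> 'C_G('F(G)) \subset 'F(G).
Proof.
move=> solG; set C := 'C_G('F(G))%G.
have nsCG : C <| G.
  by rewrite /normal subsetIl normsI ?normG ?norms_cent ?gFnorm.
have /derivedP[n sCn1] := solvableS (subsetIl G 'C('F(G))) solG.
have {sCn1} : C^`(n) \subset 'F(G) by rewrite [C^`(n)]sCn1 sub1G.
elim: n => [|n IHn] sCn; first by rewrite derg0 in sCn.
apply: IHn; set L := (C^`(n))%G; have sLC : L \subset C := der_sub n C.
rewrite Fitting_max ?gFnormal_trans // -quotient_center_nil abelian_nil //.
rewrite sub_der1_abelian //= subsetI der_sub /= centsC.
rewrite (subset_trans sLC) // (subset_trans (subsetIr G _)) //.
exact: centS sCn.
Qed.

(** A fixes N/[N, A] pointwise and, the action being coprime, fixed points lift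
to N; those that become trivial in the quotient are fixed by assumption. *)
Lemma coprime_commg_sub_cent (gT : finGroupType) (N A : {group gT}) :
    A \subset 'N(N) -> coprime #|N| #|A| -> solvable N ->
    [~: N, A] \subset 'C(A) -> N \subset 'C(A).
Proof.
move=> nNA coNA solN cRA; set R := [~: N, A]%G.
have sRN : R \subset N by rewrite commg_subl.
have nRN : N \subset 'N(R) by rewrite commg_norml.
have nRA : A \subset 'N(R) by rewrite commg_normr.
have := coprime_quotient_cent sRN nRA coNA solN.
have -> : 'C_(N / R)(A / R) = N / R.
  by apply/setIidPl; rewrite quotient_cents2.
move=> defC; suffices : N \subset 'C_N(A) by rewrite subsetI subxx.
by rewrite -(quotientSGK nRN) ?defC // subsetI sRN.
Qed.

Lemma commg_sub_norm (gT : finGroupType) (N D : {group gT}) (b : gT) :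
  D \subset N -> {in N, forall n, [~ n, b] \in D} -> b \in 'N(D).
Proof.
move=> sDN NbD; apply/normP/eqP; rewrite eqEcard cardJg leqnn andbT.
apply/subsetP=> _ /imsetP[d Dd ->]; rewrite -[d ^ b](mulKVg d) -commgEl.
by rewrite groupM ?NbD // (subsetP sDN).
Qed.

(** If g fixes no element of M but 1, then y |-> [y, g] is injective on M,
hence onto since M is finite. *)
Lemma commg_surj_fpf (gT : finGroupType) (M : {group gT}) (g m : gT) :
    g \in 'N(M) -> 'C_M[g] = 1 -> m \in M -> exists2 y, y \in M & [~ y, g] = m.
Proof.
move=> nMg cMg1 Mm; pose f y := [~ y, g].
have inj_f : {in M &, injective f}.
  move=> y z My Mz; rewrite /f !commgEl => eq_yz.
  have : z * y^-1 \in 'C_M[g].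
    rewrite inE groupM ?groupV //=; apply/cent1P/commgP.
    rewrite commgEl invMg invgK conjMg conjVg -[z ^ g](mulKVg z) -eq_yz.
    by move: (y ^ g) => v; rewrite !mulgA !(mulgK, mulgVK, mulgV).
  by rewrite cMg1 => /set1P/(canRL (mulgKV _)) ->; rewrite mul1g.
have sfM : f @: M \subset M.
  apply/subsetP=> _ /imsetP[y My ->]; rewrite /f commgEl.
  by rewrite groupMl ?groupV // memJ_norm.
have : m \in f @: M.
  suffices -> : f @: M = M by [].
  by apply/eqP; rewrite eqEcard sfM (card_in_imset inj_f) leqnn.
by case/imsetP=> y My ->; exists y.
Qed.

(** The automorphism group of a cyclic group is abelian. *)
Lemma commg_cent_cyclic (gT : finGroupType) (N : {group gT}) (a b : gT) :
  cyclic N -> a \in 'N(N) -> b \in 'N(N) -> [~ a, b] \in 'C(N).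
Proof.
case/cyclicP=> z defN nNa nNb; rewrite defN cent_cycle.
have Nz : z \in N by rewrite defN cycle_id.
have /cycleP[i za] : z ^ a \in <[z]> by rewrite -defN memJ_norm.
have /cycleP[j zb] : z ^ b \in <[z]> by rewrite -defN memJ_norm.
apply/cent1P/commute_sym/commgP/conjg_fixP.
have cab w : w \in <[z]> -> w ^ (a * b) = w ^ (b * a).
  case/cycleP=> k ->; rewrite !conjgM !conjXg za zb !conjXg za zb.
  by rewrite -!expgM mulnCA.
have zV : z ^ (b * a)^-1 \in <[z]>.
  by rewrite -defN memJ_norm // groupV groupM.
by rewrite -{1}(conjgKV (b * a) z) -conjgM -commgC cab ?conjgKV.
Qed.

(** A minimal N-invariant subgroup of W is a faithful irreducible N-module, and
an abelian group with such a module is cyclic by Schur's lemma. *)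
Lemma abelian_fpf_cyclic (gT : finGroupType) (p : nat) (W N : {group gT}) :
    p.-abelem W -> W :!=: 1 -> N \subset 'N(W) -> abelian N ->
    {in N^#, forall c, 'C_W[c] = 1} ->
  cyclic N.
Proof.
move=> abW ntW nWN abN fpf; have [W0 minW0 sW0W] := minnormal_exists ntW nWN.
have [/andP[ntW0 nW0N] _] := mingroupP minW0.
have abW0 := abelemS sW0W abW.
have cNW0 : 'C_N(W0) = 1.
  apply/trivgP/subsetP=> c /setIP[Nc cW0c].
  apply: contraR ntW0; rewrite inE => ntc.
  rewrite -subG1 -(fpf c) ?inE ?ntc //.
  by rewrite subsetI sW0W sub_cent1.
have /(abelem_mx_irrP abW0 ntW0 nW0N) irrW0 := minW0.
apply: mx_faithful_irr_abelian_cyclic irrW0 abN.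
exact: abelem_mx_faithful.
Qed.

(** * Groups whose commutators have prime power order *)

Lemma prime_power_order_p_elt (gT : finGroupType) (z : gT) :
  prime_power_order z -> exists q : nat, q.-elt z.
Proof.
case=> q [k [q_pr oz]]; exists q.
by rewrite /p_elt oz pnatX pnat_id.
Qed.

Lemma prime_power_orderJ (gT : finGroupType) (z y : gT) :
  prime_power_order z -> prime_power_order (z ^ y).
Proof. by case=> q [k]; exists q, k; rewrite orderJ. Qed.

Lemma CPPO_groupS (gT : finGroupType) (G H : {group gT}) :
  H \subset G -> CPPO_group G -> CPPO_group H.
Proof. by move=> sHG cG a b /(subsetP sHG) Ga /(subsetP sHG) Gb; apply: cG. Qed.

Lemma CPPO_quotient (gT : finGroupType) (G N : {group gT}) :
  CPPO_group G -> CPPO_group (G / N).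
Proof.
move=> cG _ _ /morphimP[a Na Ga ->] /morphimP[b Nb Gb ->].
have [q [k [q_pr ok]]] := cG _ _ Ga Gb.
rewrite -morphR //=.
have /(dvdn_pfactor _ _ q_pr)[j _ oj] : #[coset N [~ a, b]] %| q ^ k.
  by rewrite -ok morph_order ?groupR.
by exists q, j.
Qed.

(** The commutator [n a^-1, b] is conjugate to [n, b] c^-1 with c = [a, b].  In
the quotient by D = [N, c] the p-element [n, b] and the p'-element c^-1 commute,
so their product has prime power order only if one of them lies in D; c does
not, since D is a p-group. *)
Lemma CPPO_commg_sub (gT : finGroupType) (p : nat) (G N : {group gT})
    (a b : gT) :
    CPPO_group G -> N <| G -> p.-group N -> a \in G -> b \in G ->
    p^'.-elt [~ a, b] -> [~ a, b] != 1 ->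
  {in N, forall n, [~ n, b] \in [~: N, <[ [~ a, b] ]>]}.
Proof.
move=> cG /andP[sNG nNG] pN Ga Gb p'c ntc n Nn; set c := [~ a, b] in p'c ntc *.
have Nd : [~ n, b] \in N.
  by rewrite commgEl groupM ?groupV // memJ_norm // (subsetP nNG).
have nNc: c \in 'N(N) by rewrite (subsetP nNG) ?groupR.
set D := [~: N, _]; have nDN: N \subset 'N(D) by apply: commg_norml.
have nDc: c \in 'N(D) by rewrite -cycle_subG commg_normr.
have sDN: D \subset N by rewrite commg_subl cycle_subG.
have := prime_power_orderJ a (cG (n * a^-1) b _ Gb).
have ->: [~ n * a^-1, b] ^ a = [~ n, b] * c^-1.
  rewrite commMgJ conjMg conjgKV invg_comm; congr (_ * _).
  by rewrite /commg /conjg !invgK !mulgA mulVg mul1g.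
have Gna : n * a^-1 \in G by rewrite groupM ?groupV // (subsetP sNG).
move=> /(_ Gna)/prime_power_order_p_elt[q].
have nDd := subsetP nDN _ Nd.
move/(morph_p_elt (coset_morphism D)); rewrite groupM ?groupV // => /(_ isT).
rewrite morphM ?groupV // morphV //= => q_dc.
case: (p_elt_mul_commute_eq1 (p := p) _ _ _ q_dc).
- by rewrite (morph_p_elt (coset_morphism D)) // (mem_p_elt pN).
- by rewrite p_eltV (morph_p_elt (coset_morphism D)).
- apply: commuteV; apply/commgP; rewrite -morphR //=.
  by rewrite coset_id // mem_commg ?cycle_id.
- exact: coset_idr.
move/eqP; rewrite invg_eq1 => /eqP/coset_idr Dc.
case/negP: ntc.
apply/eqP; rewrite -(constt_p_elt p'c); apply/constt1P.
by rewrite p_eltNK (mem_p_elt pN) // (subsetP sDN) ?Dc.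
Qed.

Lemma CPPO_commg_subl (gT : finGroupType) (p : nat) (G N : {group gT})
    (a b : gT) :
    CPPO_group G -> N <| G -> p.-group N -> a \in G -> b \in G ->
    p^'.-elt [~ a, b] -> [~ a, b] != 1 ->
  {in N, forall n, [~ n, a] \in [~: N, <[ [~ a, b] ]>]}.
Proof.
move=> cG nsNG pN Ga Gb; rewrite -(invg_comm b a) p_eltV invg_eq1 cycleV.
exact: CPPO_commg_sub cG nsNG pN Gb Ga.
Qed.

(** For a fixed x the elements y with [x, y] in N_i form a subgroup, and so do
the elements central modulo N_i; a group is never the union of two proper
subgroups, so both choices can avoid N1 and N2 simultaneously. *)
Lemma commg_notin_two_normal (gT : finGroupType) (G N1 N2 : {group gT}) :
    N1 <| G -> N2 <| G -> ~~ (G^`(1) \subset N1) -> ~~ (G^`(1) \subset N2) ->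
  exists a b, [/\ a \in G, b \in G, [~ a, b] \notin N1 & [~ a, b] \notin N2].
Proof.
move=> nsN1G nsN2G nab1 nab2.
have centre (N : {group gT}) : N <| G -> ~~ (G^`(1) \subset N) ->
    ~~ (G \subset coset N @*^-1 'Z(G / N)).
  case/andP=> _ nNG; apply: contra => sGZ; rewrite der1_min // /abelian.
  by rewrite (subset_trans _ (subsetIr (G / N) _)) // sub_morphim_pre.
have central (N : {group gT}) x : N <| G -> x \in G ->
    x \notin coset N @*^-1 'Z(G / N) ->
    ~~ (G \subset coset N @*^-1 'C[coset N x]).
  case/andP=> _ nNG Gx; apply: contra => sGC; have Nx := subsetP nNG x Gx.
  rewrite mem_morphpre // inE mem_morphim //= -sub_cent1.
  by rewrite -sub_morphim_pre in sGC.
have [x Gx /andP[ncx1 ncx2]] :=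
  not_sub_two_groups (centre _ nsN1G nab1) (centre _ nsN2G nab2).
have [y Gy /andP[ncy1 ncy2]] :=
  not_sub_two_groups (central _ _ nsN1G Gx ncx1) (central _ _ nsN2G Gx ncx2).
have notin (N : {group gT}) : N <| G ->
    y \notin coset N @*^-1 'C[coset N x] -> [~ x, y] \notin N.
  case/andP=> _ nNG; apply: contra => Nxy.
  have [Nx Ny] := (subsetP nNG x Gx, subsetP nNG y Gy).
  rewrite mem_morphpre //; apply/cent1P; apply/commgP.
  by rewrite -morphR //= coset_id // -groupV invg_comm.
by exists x, y; split; rewrite ?notin.
Qed.

Lemma CPPO_der1_normal_Hall (gT : finGroupType) (q : nat) (G A B : {group gT}) :
    CPPO_group G -> q.-Hall(G^`(1)) A -> q^'.-Hall(G^`(1)) B ->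
    A <| G -> B <| G ->
  (G^`(1) \subset A) || (G^`(1) \subset B).
Proof.
move=> cG hallA hallB nsAG nsBG; apply: contraT.
rewrite negb_or => /andP[nA nB].
have nsG' (C : {group gT}) pi : pi.-Hall(G^`(1)) C -> C <| G -> C <| G^`(1).
  move=> hallC /andP[_ nCG].
  by rewrite /normal (pHall_sub hallC) (subset_trans (der_sub 1 G)).
have [a [b [Ga Gb]]] := commg_notin_two_normal nsAG nsBG nA nB.
have G'c : [~ a, b] \in G^`(1) by rewrite mem_commg.
rewrite (mem_normal_Hall hallA (nsG' _ _ hallA nsAG) G'c).
rewrite (mem_normal_Hall hallB (nsG' _ _ hallB nsBG) G'c).
have [s sc] := prime_power_order_p_elt (cG a b Ga Gb).
have [<- | neqsq] := eqVneq s q; first by rewrite sc.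
move=> _; case/negP; apply: sub_p_elt sc => t; rewrite !inE => /eqP->.
by rewrite neqsq.
Qed.

Lemma CPPO_nilpotent_der1 (gT : finGroupType) (G : {group gT}) (q : nat) :
  CPPO_group G -> nilpotent G^`(1) -> q.-group G^`(1) || q^'.-group G^`(1).
Proof.
move=> cG nilG'; have hallO pi := nilpotent_pcore_Hall pi nilG'.
have nsOG pi : 'O_pi(G^`(1)) <| G.
  by apply: gFnormal_trans (der_normal 1 G).
have qO pi : G^`(1) \subset 'O_pi(G^`(1)) -> pi.-group G^`(1).
  by move=> sO; apply: pgroupS sO (pcore_pgroup _ _).
have := CPPO_der1_normal_Hall cG (hallO q) (hallO q^') (nsOG q) (nsOG q^').
by case/orP=> /qO->; rewrite ?orbT.
Qed.

(** Factor out O_q(G').  The Fitting subgroup F of the derived group is then a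
q'-group, and a commutator with an entry in F is both a q-element and a
q'-element; so F is central, and it contains its centraliser in G'. *)
Lemma sol_commg_pelt_der1 (gT : finGroupType) (G : {group gT}) (q : nat) :
    solvable G -> {in G &, forall x y, q.-elt [~ x, y]} ->
  q.-group G^`(1).
Proof.
move=> solG qG; set M := 'O_q(G^`(1))%G.
have nsMG : M <| G by apply: gFnormal_trans (der_normal 1 G).
suffices trQ : (G / M)^`(1) \subset [1 _].
  apply: pgroupS (pcore_pgroup q G^`(1)).
  have nMG' := subset_trans (der_sub 1 G) (normal_norm nsMG).
  by rewrite -(quotient_sub1 nMG') quotient_der ?normal_norm.
have qGb : {in G / M &, forall x y : coset_of M, q.-elt [~ x, y]}.
  move=> _ _ /morphimP[x Nx Gx ->] /morphimP[y Ny Gy ->].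
  by rewrite -morphR // morph_p_elt ?groupR ?qG.
set Gb := (G / M)%G in qGb *; set K := Gb^`(1)%G; set F := 'F(K)%G.
have solK : solvable K := solvableS (der_sub 1 Gb) (quotient_sol _ solG).
have nsFG : F <| Gb by apply: gFnormal_trans (der_normal 1 Gb).
have trO : 'O_q(K) = 1.
  by rewrite /= -quotient_der ?normal_norm // trivg_pcore_quotient.
have q'F : q^'.-group F.
  have /dprodP[_ defF _ _] := nilpotent_pcoreC q (Fitting_nil K).
  by rewrite -defF p_core_Fitting trO mul1g pcore_pgroup.
have sKF : K \subset F.
  rewrite (subset_trans _ (cent_sub_Fitting solK)) // subsetI subxx /=.
  apply: (subset_trans (der_sub 1 Gb)); apply/centsP=> g Gg f Ff.
  apply/commgP; have [sFG nFG] := andP nsFG.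
  have qc : q.-elt [~ g, f] by rewrite qGb // (subsetP sFG).
  have Fc : [~ g, f] \in F.
    by rewrite commgEr groupM // memJ_norm ?groupV // (subsetP nFG).
  rewrite -(constt_p_elt qc); apply/eqP/constt1P.
  exact: mem_p_elt q'F Fc.
rewrite gen_subG; apply/subsetP=> _ /imset2P[x y Gx Gy ->]; apply/set1P.
rewrite -(constt_p_elt (qGb x y Gx Gy)); apply/constt1P.
by apply: mem_p_elt q'F _; rewrite (subsetP sKF) // mem_commg.
Qed.

(** In the group that G induces on N, every commutator is a q-element. *)
Lemma der1_p'elt_cent (gT : finGroupType) (G N : {group gT}) (q : nat) :
    solvable G -> N <| G ->
    {in G &, forall x y, ~~ q.-elt [~ x, y] -> [~ x, y] \in 'C(N)} ->
  {in G^`(1), forall u, q^'.-elt u -> u \in 'C(N)}.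
Proof.
move=> solG /andP[sNG nNG] cN u G'u q'u; set C := 'C_G(N)%G.
have nCG : G \subset 'N(C) by rewrite normsI ?normG ?norms_cent.
have Gu : u \in G by apply: subsetP (der_sub 1 G) u G'u.
have qQ : q.-group (G / C)^`(1).
  apply: sol_commg_pelt_der1; first exact: quotient_sol.
  move=> _ _ /morphimP[x Nx Gx ->] /morphimP[y Ny Gy ->]; rewrite -morphR //.
  have [q_xy | not_q_xy] := boolP (q.-elt [~ x, y]).
    by rewrite morph_p_elt ?groupR.
  by rewrite /= coset_id ?p_elt1 // inE groupR ?cN.
have Nu := subsetP nCG u Gu.
have: u \in C; last by case/setIP.
apply: coset_idr => //; have q'cu : q^'.-elt (coset C u).
  by rewrite (morph_p_elt (coset_morphism C)).
rewrite -(constt_p_elt q'cu); apply/constt1P; rewrite p_eltNK.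
by apply: mem_p_elt qQ _; rewrite /= -quotient_der // mem_morphim.
Qed.

Lemma two_primes_p'nat (q r : nat) m n :
    {subset \pi(n) <= [:: q; r]} -> 0 < n -> m %| n -> q^'.-nat m -> r.-nat m.
Proof.
move=> qr n_gt0 dv_mn; apply: sub_in_pnat => s pi_s q's.
have := qr s (pi_of_dvd dv_mn n_gt0 pi_s).
by rewrite !inE in q's *; rewrite (negPf q's).
Qed.

(** Let C be the centraliser of O_q(G).  Its q-elements also centralise O_r(G),
hence the whole Fitting subgroup F, so they lie in O_q(G) and are central in C.
Thus C/Z(C) is an r-group, C is nilpotent, and C <= F.  As C contains the
r-elements, so does F; exchanging q and r, F contains the q-elements too. *)
Lemma sol_two_primes_nilpotent (gT : finGroupType) (G : {group gT})
    (q r : nat) :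
    solvable G -> q != r -> {subset \pi(G) <= [:: q; r]} ->
    {in G, forall u, q^'.-elt u -> u \in 'C('O_q(G))} ->
    {in G, forall u, r^'.-elt u -> u \in 'C('O_r(G))} ->
  nilpotent G.
Proof.
move=> solG; wlog suffices sCF : q r / q != r -> {subset \pi(G) <= [:: q; r]} ->
    {in G, forall u, q^'.-elt u -> u \in 'C('O_q(G))} ->
    {in G, forall u, r^'.-elt u -> u \in 'C('O_r(G))} ->
  {in G, forall u, q^'.-elt u -> u \in 'F(G)}.
  move=> neq_qr qrG cq cr.
  suffices sGF : G \subset 'F(G) by apply: nilpotentS sGF (Fitting_nil G).
  apply/subsetP=> u Gu; rewrite -(consttC q u) groupM //.
    apply: (sCF r q) => //; rewrite 1?eq_sym ?groupX //.
      by move=> s /qrG; rewrite !inE orbC.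
    apply: sub_p_elt (p_elt_constt q u) => s; rewrite !inE => /eqP->.
    exact: neq_qr.
  by apply: (sCF q r) => //; rewrite ?groupX ?p_elt_constt.
move=> neq_qr qrG cq cr u Gu q'u; set C := 'C_G('O_q(G))%G.
have sFO : 'F(G) \subset 'O_q(G) * 'O_r(G).
  have /dprodP[_ defF _ _] := nilpotent_pcoreC q (Fitting_nil G).
  rewrite -{1}defF mulgSS ?pcore_Fitting // pcore_max ?gFnormal_trans //.
  apply: (two_primes_p'nat (n := #|G|) qrG) _ _ (pcore_pgroup _ _) => //.
  by rewrite cardSg // !gFsub_trans.
have qC : {in C, forall v, q.-elt v -> v \in 'Z(C)}.
  move=> v Cv qv; have [Gv cv] := setIP Cv.
  have Fv : v \in 'F(G).
    apply: (subsetP (cent_sub_Fitting solG)); rewrite inE Gv /=.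
    apply: (subsetP (centS sFO)); rewrite centM inE cv cr //.
    apply: sub_p_elt qv => s; rewrite !inE => /eqP->; exact: neq_qr.
  have Ov : v \in 'O_q(G).
    have hallO := nilpotent_pcore_Hall q (Fitting_nil G).
    by rewrite -p_core_Fitting (mem_normal_Hall hallO (pcore_normal _ _)).
  rewrite inE Cv; apply/centP=> w /setIP[_ /centP cw].
  by apply: commute_sym; apply: cw.
have nilC : nilpotent C.
  rewrite -quotient_center_nil; have [P sylP] := Sylow_exists q C.
  have sPZ : P \subset 'Z(C).
    apply/subsetP=> v Pv; apply: qC; first exact: subsetP (pHall_sub sylP) v Pv.
    exact: mem_p_elt (pHall_pgroup sylP) Pv.
  apply: (@pgroup_nil _ r); rewrite pgroupE card_quotient ?gFnorm //.
  apply: (two_primes_p'nat (n := #|G|) qrG) _ _ _ => //.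
    exact: dvdn_trans (dvdn_indexg _ _) (cardSg (subsetIl _ _)).
  have [_ _] := and3P sylP; apply: pnat_dvd.
  by rewrite -(Lagrange_index (center_sub C) sPZ) dvdn_mulr.
suffices: u \in C.
  apply/subsetP; rewrite Fitting_max // /normal subsetIl.
  by rewrite normsI ?normG ?norms_cent ?gFnorm.
by rewrite inE Gu cq.
Qed.

(** If every commutator of order prime to s centralised O_s(G') for both primes
s, then G' would be nilpotent, hence a group of prime power order. *)
Lemma CPPO_two_primes_action (gT : finGroupType) (G : {group gT}) (q r : nat) :
    CPPO_group G -> solvable G -> primes #|G^`(1)| = [:: q; r] ->
  exists (s : nat) a b,
    [/\ a \in G, b \in G, s^'.-elt [~ a, b] & [~ a, b] \notin 'C('O_s(G^`(1)))].
Proof.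
move=> cG solG def_qr; set K := G^`(1)%G.
have neq_qr : q != r.
  by have := primes_uniq #|K|; rewrite def_qr /= inE andbT.
pose bad (s : nat) := [exists a in G, exists b in G,
  s^'.-elt [~ a, b] && ([~ a, b] \notin 'C('O_s(K)))].
have badP (s : nat) : bad s -> exists (s : nat) a b,
    [/\ a \in G, b \in G, s^'.-elt [~ a, b] & [~ a, b] \notin 'C('O_s(K))].
  case/exists_inP=> a Ga /exists_inP[b Gb /andP[s'ab ncab]].
  by exists s, a, b.
have [/badP// | not_bad_q] := boolP (bad q).
have [/badP// | not_bad_r] := boolP (bad r).
have cK (s : nat) : ~~ bad s ->
    {in K, forall u, s^'.-elt u -> u \in 'C('O_s(K))}.
  move=> not_bad_s; apply: der1_p'elt_cent => // [|a b Ga Gb not_s_ab].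
    by apply: gFnormal_trans (der_normal 1 G).
  apply: contraR not_bad_s => ncab; apply/exists_inP; exists a => //.
  apply/exists_inP; exists b => //; rewrite ncab andbT.
  have [t tab] := prime_power_order_p_elt (cG a b Ga Gb).
  apply: (sub_p_elt _ (tab)) => p; rewrite !inE => /eqP->.
  by apply: contraNneq not_s_ab => eq_ts; rewrite -eq_ts.
have nilK : nilpotent K.
  apply: (sol_two_primes_nilpotent (q := q) (r := r)) => //; try exact: cK.
    exact: solvableS (der_sub 1 G) solG.
  by move=> s; rewrite inE def_qr.
have in_qr (s : nat) : s \in [:: q; r] -> s \in \pi(K) by rewrite -def_qr.
case/orP: (CPPO_nilpotent_der1 q cG nilK) => [qK | q'K].
  have := pnatPpi qK (in_qr r _); rewrite !inE eqxx orbT => /(_ isT).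
  by rewrite eq_sym (negPf neq_qr).
by have := pnatPpi q'K (in_qr q _); rewrite !inE eqxx => /(_ isT).
Qed.

(** * Commutators over an abelian group *)

(** The deviation of [a t, b s] from [a, b].  On an abelian group it is additive
in (t, s) and is given by the Fox derivatives of the commutator word. *)
Definition commg_shift (gT : finGroupType) (a b t s : gT) : gT :=
  (t^-1) ^ [~ a, b] * (s^-1) ^ (a ^ b) * t ^ b * s.

Lemma commg_shiftE (gT : finGroupType) (a b t s : gT) :
  [~ a * t, b * s] = [~ a, b] * commg_shift a b t s.
Proof.
rewrite /commg_shift /commg /conjg !invMg !invgK !mulgA.
by rewrite !(mulgK, mulgVK, mulVg, mul1g).
Qed.

Lemma morph_commg_shift (gT rT : finGroupType) (D : {group gT})
    (f : {morphism D >-> rT}) (a b t s : gT) :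
    a \in D -> b \in D -> t \in D -> s \in D ->
  f (commg_shift a b t s) = commg_shift (f a) (f b) (f t) (f s).
Proof.
move=> Da Db Dt Ds; rewrite /commg_shift.
by rewrite !(morphM, morphJ, morphV, morphR) ?(groupM, groupJ, groupV, groupR).
Qed.

Section Abelian.

Variables (gT : finGroupType) (M : {group gT}) (a b : gT).
Implicit Types t s u v w x y z : gT.
Hypotheses (abM : abelian M) (nMa : a \in 'N(M)) (nMb : b \in 'N(M)).

Let M_x w : w \in M -> w ^ [~ a, b] \in M.
Proof. by move=> Mw; rewrite memJ_norm ?groupR. Qed.
Let M_A w : w \in M -> w ^ (a ^ b) \in M.
Proof. by move=> Mw; rewrite memJ_norm ?groupJ. Qed.
Let M_b w : w \in M -> w ^ b \in M.
Proof. by move=> Mw; rewrite memJ_norm. Qed.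

Let mulMC : {in M &, commutative *%g}.
Proof. by move=> u v Mu Mv; apply: (centsP abM). Qed.

Lemma commg_shift_in t s : t \in M -> s \in M -> commg_shift a b t s \in M.
Proof.
move=> Mt Ms; have [Mt' Ms'] : t^-1 \in M /\ s^-1 \in M by rewrite !groupV.
exact: groupM (groupM (groupM (M_x Mt') (M_A Ms')) (M_b Mt)) Ms.
Qed.

Let mulMCA x y z w : x \in M -> y \in M -> z \in M -> w \in M ->
  (x * y) * (z * w) = (x * z) * (y * w).
Proof.
move=> Mx My Mz Mw; rewrite -!mulgA; congr (_ * _).
by rewrite !mulgA (mulMC My Mz).
Qed.

Lemma commg_shiftM t s t' s' :
    t \in M -> s \in M -> t' \in M -> s' \in M ->
  commg_shift a b (t * t') (s * s') =
    commg_shift a b t s * commg_shift a b t' s'.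
Proof.
move=> Mt Ms Mt' Ms'; rewrite /commg_shift.
have [MtV MsV] : t^-1 \in M /\ s^-1 \in M by rewrite !groupV.
have [MtV' MsV'] : t'^-1 \in M /\ s'^-1 \in M by rewrite !groupV.
rewrite !invMg (mulMC MtV' MtV) (mulMC MsV' MsV) !conjMg.
have [AM AM'] := (M_x MtV, M_x MtV'); have [BM BM'] := (M_A MsV, M_A MsV').
have [CM CM'] := (M_b Mt, M_b Mt').
have [ABM ABM'] := (groupM AM BM, groupM AM' BM').
have [ABCM ABCM'] := (groupM ABM CM, groupM ABM' CM').
rewrite (mulMCA AM AM' BM BM') (mulMCA ABM ABM' CM CM').
by rewrite (mulMCA ABCM ABCM' Ms Ms').
Qed.

Lemma commg_shiftV t s : t \in M -> s \in M ->
  commg_shift a b t^-1 s^-1 = (commg_shift a b t s)^-1.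
Proof.
move=> Mt Ms; apply: (mulgI (commg_shift a b t s)).
rewrite -commg_shiftM ?groupV // !mulgV /commg_shift.
by rewrite !(conj1g, invg1, mulg1).
Qed.

(** The pair built from w is the adjoint of [commg_shift] with respect to the
bilinear form that [commg_shift_polar] obtains from a commutator pairing; on
such pairs the shift is, with x = [a, b], the operator x^-1 - 1 followed by the
action of a b. *)
Lemma commg_shift_adjoint w : w \in M ->
  commg_shift a b ((w * (w^-1) ^ (a ^ b)) ^ [~ a, b]^-1)
                  (w * (w^-1) ^ ([~ a, b]^-1 * b)) =
    (w ^ [~ a, b]^-1 * w^-1) ^ (a * b).
Proof.
move=> Mw; rewrite /commg_shift; set x := [~ a, b].
have Mx' v : v \in M -> v ^ x^-1 \in M.
  by move=> Mv; rewrite memJ_norm ?groupV ?groupR.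
have MwV : w^-1 \in M by rewrite groupV.
set A := a ^ b; pose wA := w ^ A.
pose wxb := w ^ (x^-1 * b); pose wab := w ^ (a * b).
have ab_eq : A * (x^-1 * b) = a * b.
  rewrite /A /x /commg /conjg !invMg !invgK !mulgA.
  by rewrite !(mulgK, mulgVK, mulVg, mul1g).
have ba_eq : x^-1 * b * A = x^-1 * (a * b) by rewrite -mulgA /A conjgE mulKVg.
have -> : (((w * (w^-1) ^ A) ^ x^-1)^-1) ^ x = wA * w^-1.
  by rewrite conjVg conjgKV invMg conjVg invgK.
have -> : ((w * (w^-1) ^ (x^-1 * b))^-1) ^ A = w ^ (x^-1 * (a * b)) * wA^-1.
  by rewrite invMg conjVg invgK conjMg conjVg -conjgM ba_eq.
have -> : ((w * (w^-1) ^ A) ^ x^-1) ^ b = wxb * wab^-1.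
  by rewrite -conjgM conjMg conjVg conjVg -conjgM ab_eq.
rewrite [(w^-1) ^ _]conjVg -/wxb [RHS]conjMg conjVg -conjgM -/wab.
have MwA : wA \in M by apply: M_A.
have Mwxb : wxb \in M by rewrite /wxb conjgM; apply/M_b/Mx'.
have Nab : a * b \in 'N(M) by rewrite groupM.
have Mwab : wab \in M by rewrite memJ_norm.
have Mu : w ^ (x^-1 * (a * b)) \in M by rewrite conjgM memJ_norm // Mx'.
move: (w ^ (x^-1 * _)) Mu => u Mu.
have [MA' Mb' Mab'] : [/\ wA^-1 \in M, wxb^-1 \in M & wab^-1 \in M].
  by rewrite !groupV.
rewrite -mulgA (mulMC Mu MA') (mulMCA MwA MwV MA' Mu) mulgV mul1g.
rewrite (mulMC Mw Mb') (mulMCA Mwxb Mab' Mb' Mw) mulgV mul1g.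
by rewrite (mulMC Mab' Mw) (mulMCA MwV Mu Mw Mab') mulVg mul1g.
Qed.

End Abelian.

(** Without fixed points of [a, b] on M, every value of the shift is taken on
the image of the adjoint, which is therefore a complement of its kernel. *)
Lemma commg_shift_adjoint_onto (gT : finGroupType) (M : {group gT})
    (a b m : gT) :
    abelian M -> a \in 'N(M) -> b \in 'N(M) ->
    'C_M[ [~ a, b] ] = 1 -> m \in M ->
  exists2 w, w \in M &
    commg_shift a b ((w * (w^-1) ^ (a ^ b)) ^ [~ a, b]^-1)
                    (w * (w^-1) ^ ([~ a, b]^-1 * b)) = m.
Proof.
move=> abM nMa nMb cMx Mm.
have nMab : (a * b)^-1 \in 'N(M) by rewrite groupV groupM.
have nMx : [~ a, b]^-1 \in 'N(M) by rewrite groupV groupR.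
have cMxV : 'C_M[ [~ a, b]^-1 ] = 1.
  by rewrite -cent_cycle cycleV cent_cycle.
have Mm' : (m ^ (a * b)^-1)^-1 \in M by rewrite groupV memJ_norm.
have [y My def_y] := commg_surj_fpf nMx cMxV Mm'.
exists y^-1; rewrite ?groupV // (commg_shift_adjoint abM) ?groupV //.
apply: (@conjg_inj _ (a * b)^-1); rewrite conjgK; apply: invg_inj.
by rewrite -def_y conjVg invMg !invgK.
Qed.

(** * Commutators over a class 2 group *)

Section ClassTwo.

Variables (gT : finGroupType) (N : {group gT}).
Hypothesis sN'Z : N^`(1) \subset 'Z(N).
Implicit Types u v w : gT.

Let commg_cent u v w : u \in N -> v \in N -> w \in N -> commute [~ u, v] w.
Proof.
move=> Nu Nv Nw; have /setIP[_ /centP cuv] := subsetP sN'Z _ (mem_commg Nu Nv).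
exact: cuv.
Qed.

Lemma commgM_class2 u v w :
  u \in N -> v \in N -> w \in N -> [~ u * v, w] = [~ u, w] * [~ v, w].
Proof.
by move=> Nu Nv Nw; rewrite commMgJ conjgE (commg_cent Nu Nw Nv) mulKg.
Qed.

Lemma commMg_class2 u v w :
  u \in N -> v \in N -> w \in N -> [~ u, v * w] = [~ u, v] * [~ u, w].
Proof.
move=> Nu Nv Nw; rewrite -[LHS]invgK invg_comm commgM_class2 // invMg.
rewrite !invg_comm.
by rewrite (commg_cent Nu Nw) // groupR.
Qed.

Lemma commgV_class2 u v : u \in N -> v \in N -> [~ u^-1, v] = [~ u, v]^-1.
Proof.
move=> Nu Nv; apply: (mulgI [~ u, v]).
by rewrite -commgM_class2 ?groupV // !mulgV comm1g.
Qed.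

Lemma commVg_class2 u v : u \in N -> v \in N -> [~ u, v^-1] = [~ u, v]^-1.
Proof.
move=> Nu Nv.
by rewrite -[LHS]invgK invg_comm commgV_class2 // invgK -invg_comm.
Qed.

(** The polarisation of the condition [commg_shift a b t s = 1]: moving the
factors of the product for [(t * t', s * s')] into the order of the product of
the two shifts costs exactly two commutators, both central. *)
Lemma commg_shift_polar a b t s t' s' :
    a \in 'N(N) -> b \in 'N(N) -> t \in N -> s \in N -> t' \in N -> s' \in N ->
    commg_shift a b t s = 1 -> commg_shift a b t' s' = 1 ->
    commg_shift a b (t * t') (s * s') = 1 ->
  [~ t ^ [~ a, b], s' ^ (a ^ b)] * [~ t' ^ b, s] = 1.
Proof.
move=> nNa nNb Nt Ns Nt' Ns'; rewrite /commg_shift.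
set x := [~ a, b]; set A := a ^ b.
have nNx : x \in 'N(N) by rewrite groupR.
have nNA : A \in 'N(N) by rewrite groupJ.
have -> : [~ t ^ x, s' ^ A] = [~ (t^-1) ^ x, (s'^-1) ^ A].
  have [Ntx NsA] : t ^ x \in N /\ s' ^ A \in N by split; rewrite memJ_norm.
  by rewrite !conjVg commVg_class2 ?groupV // commgV_class2 // invgK.
rewrite !invMg !conjMg.
have [NtV NsV] : t^-1 \in N /\ s^-1 \in N by rewrite !groupV.
have [NtV' NsV'] : t'^-1 \in N /\ s'^-1 \in N by rewrite !groupV.
have Nx v : v \in N -> v ^ x \in N by move=> Nv; rewrite memJ_norm.
have NA v : v \in N -> v ^ A \in N by move=> Nv; rewrite memJ_norm.
have Nb v : v \in N -> v ^ b \in N by move=> Nv; rewrite memJ_norm.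
have := Nx _ NtV; have := Nx _ NtV'; have := NA _ NsV; have := NA _ NsV'.
have := Nb _ Nt; have := Nb _ Nt'.
move: (t^-1 ^ x) (t'^-1 ^ x) (s^-1 ^ A) (s'^-1 ^ A) (t ^ b) (t' ^ b).
move=> n1 m1 n2 m2 n3 m3 Nm3 Nn3 Nm2 Nn2 Nm1 Nn1 Phi1 Phi1' Phi1M.
have ck1 := commg_cent Nn1 Nm2; have ck2 := commg_cent Nm3 Ns.
have Nk1 : [~ n1, m2] \in N by rewrite groupR.
have Nk2 : [~ m3, s] \in N by rewrite groupR.
have := (commgC n1 m2, commgC m3 s).
move: [~ n1, m2] [~ m3, s] => k1 k2 in ck1 ck2 Nk1 Nk2 * => -[def_k1 def_k2].
have : m1 * m2 * (n1 * n2 * n3 * s) * m3 * s' * (k1 * k2) = 1.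
  rewrite -Phi1M; transitivity (m1 * (n1 * m2) * n2 * n3 * (m3 * s) * s').
    rewrite def_k1 def_k2 -!mulgA (ck1 (n2 * _)); last by rewrite !groupM.
    by rewrite -!mulgA (ck2 (s' * _)) ?groupM // -!mulgA.
  by rewrite !mulgA.
by rewrite Phi1 mulg1 Phi1' mul1g.
Qed.

End ClassTwo.

(** The adjunction that dictates the pair built from w.  As a and b centralise
Z(N), they preserve the commutator pairing on N, so words in a and b acting on
w can be moved to the other argument, where they reassemble into the shift. *)
Lemma commg_shift_adjoint_polar (gT : finGroupType) (N : {group gT})
    (a b t s w : gT) :
    N^`(1) \subset 'Z(N) -> a \in 'N(N) -> b \in 'N(N) ->
    a \in 'C('Z(N)) -> b \in 'C('Z(N)) -> t \in N -> s \in N -> w \in N ->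
  [~ ((w * (w^-1) ^ (a ^ b)) ^ [~ a, b]^-1) ^ [~ a, b], s ^ (a ^ b)]
    * [~ t ^ b, w * (w^-1) ^ ([~ a, b]^-1 * b)] = [~ commg_shift a b t s, w].
Proof.
move=> sN'Z nNa nNb cZa cZb Nt Ns Nw; set x := [~ a, b]; set A := a ^ b.
have inv g u v : g \in 'C('Z(N)) -> u \in N -> v \in N ->
    [~ u ^ g, v ^ g] = [~ u, v].
  move=> /centP cg Nu Nv; rewrite -conjRg.
  apply/conjg_fixP/commgP/commute_sym/cg.
  by apply: (subsetP sN'Z); rewrite mem_commg.
have nNx : x \in 'N(N) by rewrite groupR.
have nNA : A \in 'N(N) by rewrite groupJ.
have cZx : x \in 'C('Z(N)) by rewrite groupR.
have cZA : A \in 'C('Z(N)) by rewrite groupJ.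
have Nx v : v \in N -> v ^ x \in N by move=> Nv; rewrite memJ_norm.
have NA v : v \in N -> v ^ A \in N by move=> Nv; rewrite memJ_norm.
have Nb v : v \in N -> v ^ b \in N by move=> Nv; rewrite memJ_norm.
have NwV : w^-1 \in N by rewrite groupV.
have NxV v : v \in N -> v ^ x^-1 \in N by move=> Nv; rewrite memJ_norm ?groupV.
have [NtV NsV] : t^-1 \in N /\ s^-1 \in N by rewrite !groupV.
have [NtVx NsVA Ntb] := And3 (Nx _ NtV) (NA _ NsV) (Nb _ Nt).
have [Ntx NsA] := (Nx _ Nt, NA _ Ns); have NwVx := NxV _ NwV.
rewrite conjgKV (conjgM _ x^-1 b) /commg_shift -/x -/A.
rewrite (commgM_class2 sN'Z Nw (NA _ NwV) NsA).
rewrite (commMg_class2 sN'Z Ntb Nw (Nb _ NwVx)).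
rewrite (inv A _ _ cZA NwV Ns) (inv b _ _ cZb Nt NwVx).
rewrite -(inv x _ _ cZx Nt NwVx) conjgKV.
rewrite (commgM_class2 sN'Z (groupM (groupM NtVx NsVA) Ntb) Ns Nw).
rewrite (commgM_class2 sN'Z (groupM NtVx NsVA) Ntb Nw).
rewrite (commgM_class2 sN'Z NtVx NsVA Nw).
rewrite !conjVg (commgV_class2 sN'Z Nw Ns) (commVg_class2 sN'Z Ntx Nw).
rewrite (commgV_class2 sN'Z Ntx Nw) (commgV_class2 sN'Z NsA Nw) !invg_comm.
have cN u v z : u \in N -> v \in N -> z \in N -> commute [~ u, v] z.
  move=> Nu Nv Nz.
  have /setIP[_ /centP cuv] := subsetP sN'Z _ (mem_commg Nu Nv).
  exact: cuv.
have [N1 N2 N3 N4] : [/\ [~ w, s ^ A] \in N, [~ s, w] \in N, [~ t ^ b, w] \in N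
                         & [~ w, t ^ x] \in N] by rewrite !groupR.
have c2 z := cN s w z Ns Nw; have c4 z := cN w (t ^ x) z Nw Ntx.
move: [~ w, s ^ A] [~ s, w] [~ t ^ b, w] [~ w, t ^ x] =>
  k1 k2 k3 k4 in N1 N2 N3 N4 c2 c4 *.
rewrite -[k1 * k2 * _]mulgA (c2 (k3 * k4)) ?groupM //.
by rewrite -!mulgA (c4 (k1 * _)) ?groupM // -!mulgA (c2 k4).
Qed.

(** Let S be the set of pairs (t, s) whose shift is central; the prime power
condition makes these shifts trivial.  The polar form then vanishes on S, and by
adjunction it vanishes between S and the image of the adjoint.  These two span
all pairs modulo Z(N), so S lies in the radical of a form without radical
modulo Z(N).  Thus the shift is injective on pairs in N/Z(N), with values in
N/Z(N), which leaves no room unless N = Z(N). *)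
Lemma class2_abelian_of_CPPO (gT : finGroupType) (q : nat) (G N : {group gT})
    (a b : gT) :
    CPPO_group G -> N \subset G -> q.-group N -> a \in G -> b \in G ->
    a \in 'N(N) -> b \in 'N(N) -> N^`(1) \subset 'Z(N) ->
    a \in 'C('Z(N)) -> b \in 'C('Z(N)) ->
    q^'.-elt [~ a, b] -> [~: N, <[ [~ a, b] ]>] = N ->
  abelian N.
Proof.
move=> cG sNG qN Ga Gb nNa nNb sN'Z cZa cZb q'x defN.
pose Z := 'Z(N)%G; pose M := (N / Z)%G; pose f := coset_morphism Z.
have [x1 | ntx] := eqVneq [~ a, b] 1.
  by rewrite -defN x1 cycle1 commG1 abelian1.
have nZN : N \subset 'N(Z) := gFnorm _ N.
have nZa : a \in 'N(Z) := subsetP (cent_sub _) a cZa.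
have nZb : b \in 'N(Z) := subsetP (cent_sub _) b cZb.
have nZx : [~ a, b] \in 'N(Z) by rewrite groupR.
have abM : abelian M := sub_der1_abelian sN'Z.
have [nMa nMb] : f a \in 'N(M) /\ f b \in 'N(M).
  by split; rewrite (subsetP (quotient_norm _ _)) // mem_morphim.
have nNx : [~ a, b] \in 'N(N) by rewrite groupR.
have fN t : t \in N -> f t \in M.
  by move=> Nt; rewrite mem_morphim ?(subsetP nZN).
have shiftN t s : t \in N -> s \in N -> commg_shift a b t s \in N.
  move=> Nt Ns; rewrite /commg_shift.
  have [NtV NsV] : t^-1 \in N /\ s^-1 \in N by rewrite !groupV.
  apply: groupM Ns; apply: groupM; last by rewrite memJ_norm.
  by apply: groupM; rewrite memJ_norm ?groupJ.
have fshift t s : t \in N -> s \in N ->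
    f (commg_shift a b t s) = commg_shift (f a) (f b) (f t) (f s).
  by move=> Nt Ns; rewrite morph_commg_shift // (subsetP nZN).
have f1Z t : t \in N -> f t = 1 -> t \in Z.
  by move=> Nt /coset_idr; apply; rewrite (subsetP nZN).
have cMx : 'C_M[ [~ f a, f b] ] = 1.
  rewrite -cent_cycle -morphR // -quotient_cycle //.
  have -> : M = [~: N / Z, <[ [~ a, b] ]> / Z]%G :> {set _}.
    by rewrite /= -quotientR ?cycle_subG // defN.
  apply: coprime_abel_cent_TI abM; first by rewrite quotient_norms ?cycle_subG.
  by apply: coprime_morph; apply: pnat_coprime qN _.
have Phi1 t s : t \in N -> s \in N -> commg_shift a b t s \in Z ->
    commg_shift a b t s = 1.
  move=> Nt Ns Zc.
  have [p pc] : exists p : nat, p.-elt [~ a * t, b * s].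
    apply: prime_power_order_p_elt; apply: cG; apply: groupM => //.
      exact: (subsetP sNG).
    exact: (subsetP sNG).
  rewrite commg_shiftE in pc; have Nc := shiftN t s Nt Ns.
  have cxc : commute (commg_shift a b t s) [~ a, b].
    have /centP cx : [~ a, b] \in 'C(Z) by rewrite groupR.
    by apply/commute_sym/cx.
  case: (p_elt_mul_commute_eq1 (p := q) (q := p) _ q'x cxc) => //.
  - exact: mem_p_elt qN Nc.
  - by rewrite cxc.
  by move/eqP; rewrite (negPf ntx).
pose S t s := [/\ t \in N, s \in N & commg_shift a b t s \in Z].
have S_Z t s : S t s -> t \in Z /\ s \in Z.
  case=> Nt Ns Sts.
  have beta1 t0 s0 : t0 \in N -> s0 \in N ->
      [~ t0 ^ [~ a, b], s ^ (a ^ b)] * [~ t ^ b, s0] = 1.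
    move=> Nt0 Ns0.
    (* Split (t0, s0) into an element of S and an adjoint pair (t2, s2). *)
    have [_ /morphimP[w nZw Nw ->] def_w] :=
      commg_shift_adjoint_onto abM nMa nMb cMx
        (commg_shift_in nMa nMb (fN _ Nt0) (fN _ Ns0)).
    have NwV : w^-1 \in N by rewrite groupV.
    set t2 := (w * (w^-1) ^ (a ^ b)) ^ [~ a, b]^-1.
    set s2 := w * (w^-1) ^ ([~ a, b]^-1 * b).
    have [Nt2 Ns2] : t2 \in N /\ s2 \in N.
      have nNxV : [~ a, b]^-1 \in 'N(N) by rewrite groupV.
      have nNxVb : [~ a, b]^-1 * b \in 'N(N) by rewrite groupM.
      have nNab : a ^ b \in 'N(N) by rewrite groupJ.
      rewrite /t2 /s2; split.
        by rewrite memJ_norm // groupMl // memJ_norm.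
      by rewrite groupMl // memJ_norm.
    have [ft2 fs2] : f t2 = (f w * (f w)^-1 ^ (f a ^ f b)) ^ [~ f a, f b]^-1
                  /\ f s2 = f w * (f w)^-1 ^ ([~ f a, f b]^-1 * f b).
      have nZwV : w^-1 \in 'N(Z) by rewrite groupV.
      have nZab : a ^ b \in 'N(Z) by rewrite groupJ.
      have nZxV : [~ a, b]^-1 \in 'N(Z) by rewrite groupV.
      have nZxVb : [~ a, b]^-1 * b \in 'N(Z) by rewrite groupM.
      rewrite -!(morphV f nZw) -(morphJ f nZa nZb) -(morphR f nZa nZb).
      rewrite -(morphV f nZx) -(morphJ f nZwV nZab) -(morphM f nZxV nZb).
      rewrite -(morphJ f nZwV nZxVb) -!(morphM f nZw) ?groupJ //.
      by rewrite -(morphJ f) // groupM // groupJ.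
    rewrite -ft2 -fs2 in def_w.
    set t1 := t0 * t2^-1; set s1 := s0 * s2^-1.
    have [Nt1 Ns1] : t1 \in N /\ s1 \in N by rewrite /t1 /s1 !groupMr ?groupV.
    have [ft1 fs1] : f t1 = f t0 * (f t2)^-1 /\ f s1 = f s0 * (f s2)^-1.
      by split; rewrite morphM ?groupV ?(subsetP nZN) // morphV ?(subsetP nZN).
    have shift1 : commg_shift a b t1 s1 \in Z.
      apply: f1Z; first exact: shiftN.
      rewrite fshift // ft1 fs1 (commg_shiftM abM nMa nMb) ?groupV ?fN //.
      by rewrite (commg_shiftV abM nMa nMb) ?fN // def_w mulgV.
    have shift1M : commg_shift a b (t1 * t) (s1 * s) \in Z.
      have [Nt1t Ns1s] := (groupM Nt1 Nt, groupM Ns1 Ns).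
      apply: f1Z; first exact: shiftN.
      have nZ v (Nv : v \in N) := subsetP nZN v Nv.
      rewrite (fshift _ _ Nt1t Ns1s) (morphM f (nZ _ Nt1) (nZ _ Nt)).
      rewrite (morphM f (nZ _ Ns1) (nZ _ Ns)).
      rewrite (commg_shiftM abM nMa nMb) ?fN // -!fshift //.
      have fZ z : z \in Z -> f z = 1 by move=> Zz; apply: coset_id.
      by rewrite (fZ _ shift1) (fZ _ Sts) mulg1.
    have polar1 := commg_shift_polar sN'Z nNa nNb Nt1 Ns1 Nt Ns
      (Phi1 _ _ Nt1 Ns1 shift1) (Phi1 _ _ Nt Ns Sts)
      (Phi1 _ _ (groupM Nt1 Nt) (groupM Ns1 Ns) shift1M).
    have polar2 := commg_shift_adjoint_polar sN'Z nNa nNb cZa cZb Nt Ns Nw.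
    rewrite -/t2 -/s2 (Phi1 _ _ Nt Ns Sts) comm1g in polar2.
    have NsA : s ^ (a ^ b) \in N by rewrite memJ_norm ?groupJ.
    have Ntb : t ^ b \in N by rewrite memJ_norm.
    have [Nt1x Nt2x] : t1 ^ [~ a, b] \in N /\ t2 ^ [~ a, b] \in N.
      by split; rewrite memJ_norm.
    rewrite -(mulgVK t2 t0) -(mulgVK s2 s0) -/t1 -/s1 conjMg.
    rewrite (commgM_class2 sN'Z Nt1x Nt2x NsA) (commMg_class2 sN'Z Ntb Ns1 Ns2).
    have Nc1 : [~ t ^ b, s1] \in N by rewrite groupR.
    have /setIP[_ /centP cc2] := subsetP sN'Z _ (mem_commg Nt2x NsA).
    move: [~ t1 ^ _, _] [~ t2 ^ _, _] [~ _, s1] [~ _, s2] cc2 Nc1 polar1 polar2.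
    move=> k1 k2 k3 k4 cc2 Nk3 k13 k24.
    by rewrite -mulgA (mulgA k2) (cc2 _ Nk3) -mulgA k24 mulg1.
  have nNA : a ^ b \in 'N(N) by rewrite groupJ.
  have inZ g v : g \in 'N(N) -> v \in N ->
      {in N, forall u, commute (v ^ g) u} -> v \in Z.
    move=> nNg Nv cv; rewrite inE Nv /=; apply/centP=> u Nu.
    apply: (@conjg_inj _ g).
    by rewrite !conjMg; apply: cv; rewrite memJ_norm.
  split.
    apply: (inZ b) => // u Nu; apply/commgP/eqP.
    by rewrite -[RHS](beta1 1 u) // conj1g comm1g mul1g.
  apply: (inZ (a ^ b)) => // u Nu; apply/commute_sym/commgP/eqP.
  have NuV : u ^ [~ a, b]^-1 \in N by rewrite memJ_norm ?groupV.
  by rewrite -[RHS](beta1 _ 1 NuV) // conjgKV commg1 mulg1.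
(* Injectivity of the shift on pairs modulo Z. *)
pose g (u : coset_of Z * coset_of Z) := commg_shift (f a) (f b) u.1 u.2.
have inj_g : {in setX M M &, injective g}.
  move=> [u v] [u' v'] /setXP[/= Mu Mv] /setXP[/= Mu' Mv']; rewrite /g /=.
  have liftM w : w \in M -> exists2 t, t \in N & w = f t.
    by case/morphimP=> t _ Nt ->; exists t.
  have [[t Nt ->] [s Ns ->]] := (liftM u Mu, liftM v Mv).
  have [[t' Nt' ->] [s' Ns' ->]] := (liftM u' Mu', liftM v' Mv').
  have [nt nt'] : t \in 'N(Z) /\ t' \in 'N(Z) by split; apply: (subsetP nZN).
  have [ns ns'] : s \in 'N(Z) /\ s' \in 'N(Z) by split; apply: (subsetP nZN).
  move=> eq_ts; have [Ntt Nss] : t * t'^-1 \in N /\ s * s'^-1 \in N.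
    by split; rewrite groupMr ?groupV.
  have [] : t * t'^-1 \in Z /\ s * s'^-1 \in Z.
    apply: S_Z; split=> //; apply: f1Z; first exact: shiftN.
    rewrite fshift // !morphM ?groupV // !morphV //.
    rewrite (commg_shiftM abM nMa nMb) ?groupV ?fN //.
    rewrite (commg_shiftV abM nMa nMb) ?fN //.
    by rewrite [commg_shift _ _ (f t) _]eq_ts mulgV.
  move=> /(coset_id (A := Z)) ft /(coset_id (A := Z)) fs.
  have eqf y z : y \in 'N(Z) -> z \in 'N(Z) -> f (y * z^-1) = 1 -> f y = f z.
    move=> ny nz; rewrite morphM ?groupV // morphV // => /(canRL (mulgVK _)) ->.
    by rewrite mul1g.
  by rewrite (eqf t t') // (eqf s s').
have sgM : g @: setX M M \subset M.
  apply/subsetP=> _ /imsetP[[u v] /setXP[Mu Mv] ->].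
  exact: commg_shift_in.
have := subset_leq_card sgM; rewrite (card_in_imset inj_g) cardsX.
rewrite -{3}[#|M|]muln1 leq_pmul2l // => leM1.
have sNZ : N \subset Z by rewrite -quotient_sub1 // subG1 trivg_card_le1.
exact: subset_trans sNZ (subsetIr N _).
Qed.

(** * A commutator acting on an abelian subgroup *)

(** Take N minimal among the subgroups of Q normalised by a and b and not
centralised by x = [a, b].  If N is nonabelian, its characteristic abelian
subgroups are proper, hence centralised by x, so N is special; its centre is
centralised by a and b, and the class 2 lemma applies. *)
Lemma CPPO_abelian_subgroup (gT : finGroupType) (q : nat) (G Q : {group gT})
    (a b : gT) :
    CPPO_group G -> Q <| G -> q.-group Q -> a \in G -> b \in G ->
    q^'.-elt [~ a, b] -> [~ a, b] \notin 'C(Q) ->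
  exists N : {group gT}, [/\ N \subset Q, a \in 'N(N), b \in 'N(N),
     abelian N & N :!=: 1 /\ [~: N, <[ [~ a, b] ]>] = N].
Proof.
move=> cG /andP[sQG nQG] qQ Ga Gb; set x := [~ a, b] => q'x ncQx.
pose gP (N : {group gT}) :=
  [&& N \subset Q, a \in 'N(N), b \in 'N(N) & x \notin 'C(N)].
have gPQ : gP Q by rewrite /gP subxx !(subsetP nQG).
have [N minN sNQ] := mingroup_exists gPQ.
have [/and4P[_ nNa nNb ncNx] minP] := mingroupP minN.
have qN := pgroupS sNQ qQ; have sNG := subset_trans sNQ sQG.
have ntx : x != 1 by apply: contraNneq ncNx => ->.
have nNx : x \in 'N(N) by rewrite groupR.
(* A subgroup normalised by a and b is normal in the group that they generate
   together with it, and there the commutator inclusion applies. *)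
have star (K : {group gT}) : K \subset N -> a \in 'N(K) -> b \in 'N(K) ->
    {in K, forall k, [~ k, a] \in [~: K, <[x]>] /\ [~ k, b] \in [~: K, <[x]>]}.
  move=> sKN nKa nKb k Kk; pose E := (K <*> (<[a]> <*> <[b]>))%G.
  have sEG : E \subset G.
    by rewrite !join_subG !cycle_subG Ga Gb (subset_trans sKN sNG).
  have nsKE : K <| E.
    by rewrite /normal joing_subl !join_subG normG !cycle_subG nKa.
  have [Ea Eb] : a \in E /\ b \in E.
    have sABE : <[a]> <*> <[b]> \subset E by apply: joing_subr.
    by split; rewrite -cycle_subG (subset_trans _ sABE) ?joing_subl ?joing_subr.
  have cE := CPPO_groupS sEG cG; have qK := pgroupS sKN qN.
  by rewrite (CPPO_commg_subl cE nsKE qK) ?(CPPO_commg_sub cE nsKE qK).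
have small (K : {group gT}) :
    K \subset N -> K :!=: N -> a \in 'N(K) -> b \in 'N(K) -> x \in 'C(K).
  move=> sKN neqKN nKa nKb; apply: contraNT neqKN => ncKx; apply/eqP.
  by apply: minP; rewrite // /gP (subset_trans sKN sNQ) nKa nKb.
have small_ab (K : {group gT}) :
    K \subset N -> K :!=: N -> a \in 'N(K) -> b \in 'N(K) ->
    (a \in 'C(K)) && (b \in 'C(K)).
  move=> sKN neqKN nKa nKb; have cKx := small K sKN neqKN nKa nKb.
  have R1 : [~: K, <[x]>] = 1 by apply/commG1P; rewrite centsC cycle_subG.
  have st := star K sKN nKa nKb.
  apply/andP; split; apply/centP=> k Kk; apply/commute_sym/commgP/eqP/set1P.
    by have [] := st k Kk; rewrite R1.
  by have [_] := st k Kk; rewrite R1.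
have defN : [~: N, <[x]>] = N.
  have sRN : [~: N, <[x]>] \subset N by rewrite commg_subl cycle_subG.
  have st := star N (subxx _) nNa nNb.
  have nRa : a \in 'N([~: N, <[x]>]) by apply: (commg_sub_norm sRN) => n /st[].
  have nRb : b \in 'N([~: N, <[x]>]) by apply: (commg_sub_norm sRN) => n /st[].
  apply/eqP; apply: contraNT ncNx => neqRN.
  rewrite -sub_cent1 -cent_cycle; apply: coprime_commg_sub_cent.
  - by rewrite cycle_subG.
  - exact: pnat_coprime qN q'x.
  - exact: pgroup_sol qN.
  by rewrite centsC cycle_subG small.
exists N; split=> //; last first.
  by split=> //; apply: contraNneq ncNx => ->; rewrite cent1T inE.
apply: contraT => nabN.
have coNx : coprime #|N| #|<[x]>| := pnat_coprime qN q'x.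
have neqZ : 'Z(N) != N by apply: contraNneq nabN => <-; apply: center_abelian.
have nZ g : g \in 'N(N) -> g \in 'N('Z(N)).
  by move=> nNg; rewrite (subsetP (char_norms (center_char N))).
have [] := @abelian_charsimple_special _ q <[x]>%G N qN coNx defN.
  apply/bigcupsP=> K /andP[chK abK]; rewrite centsC cycle_subG.
  have nK := subsetP (char_norms chK).
  apply: small; rewrite ?nK ?char_sub //.
  by apply: contraNneq nabN => <-.
case=> _ defN' _.
have [cZa cZb] :=
  andP (small_ab 'Z(N)%G (center_sub N) neqZ (nZ a nNa) (nZ b nNb)).
have sN'Z : N^`(1) \subset 'Z(N) by rewrite defN'.
case/negP: nabN.
exact: (class2_abelian_of_CPPO cG sNG qN Ga Gb nNa nNb sN'Z cZa cZb q'x defN).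
Qed.

(** Every c <> 1 in N is a commutator [y, x] with x = [a, b], so x centralises
V/[V, c]; hence so does N = [N, x].  By coprimality c has no fixed point in
[V, c], a fortiori none in [V, N].  If V did not centralise N, then N would be
cyclic and x would centralise it. *)
Lemma CPPO_abelian_action (gT : finGroupType) (p q : nat)
    (G V N : {group gT}) (a b : gT) :
    CPPO_group G -> V <| G -> p.-abelem V ->
    N \subset G -> a \in G -> b \in G ->
    p^'.-group N -> abelian N -> N :!=: 1 -> a \in 'N(N) -> b \in 'N(N) ->
    q.-group N -> q^'.-elt [~ a, b] -> [~: N, <[ [~ a, b] ]>] = N ->
  V \subset 'C(N).
Proof.
move=> cG nsVG abV sNG Ga Gb p'N abN ntN nNa nNb qN q'x defN.
set x := [~ a, b] in q'x defN *.
have [sVG nVG] := andP nsVG; have [pV cVV _] := and3P abV.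
have nNx : x \in 'N(N) by rewrite groupR.
have Gx : x \in G by rewrite groupR.
have cNx : 'C_N[x] = 1.
  rewrite -cent_cycle -defN; apply: coprime_abel_cent_TI => //.
    by rewrite cycle_subG.
  exact: pnat_coprime qN q'x.
apply: contraR ntN => ncVN.
have ntW : [~: V, N] != 1 by apply: contraNneq ncVN => /commG1P.
have sWV : [~: V, N] \subset V by rewrite commg_subl (subset_trans sNG).
have nVN := subset_trans sNG nVG.
have sWc c : c \in N^# -> [~: V, N] \subset [~: V, <[c]>].
  case/setD1P=> ntc Nc; have [y Ny def_c] := commg_surj_fpf nNx cNx Nc.
  set D := [~: V, <[c]>]%G.
  have sDV : D \subset V by rewrite commg_subl cycle_subG (subsetP nVN).
  have nDV : V \subset 'N(D) by apply: commg_norml.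
  have nDN : N \subset 'N(D).
    by rewrite normsR // sub_abelian_norm // cycle_subG.
  have sVx : {in V, forall v, [~ v, x] \in D}.
    move=> v Vv; have Gy := subsetP sNG y Ny.
    have := CPPO_commg_sub cG nsVG pV Gy Gx; rewrite def_c; apply=> //.
    exact: mem_p_elt p'N Nc.
  have nDx : x \in 'N(D) by apply: commg_sub_norm sVx.
  have cVDx : <[x]> / D \subset 'C(V / D).
    rewrite quotient_cycle // cycle_subG; apply/centP=> _ /morphimP[v nv Vv ->].
    by apply/commute_sym/commgP; rewrite -morphR //= coset_id ?sVx.
  have : [~: N / D, <[x]> / D] \subset 'C(V / D).
    apply: comm_norm_cent_cent => //.
      by rewrite quotient_norms ?cycle_subG.
    by rewrite quotient_norms.
  rewrite -quotientR ?cycle_subG // defN => cVDN.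
  by rewrite commGC -quotient_cents2.
have cycN : cyclic N.
  apply: (abelian_fpf_cyclic (abelemS sWV abV)) => // [|c Nc].
    by rewrite normsR ?normG.
  have [ntc Nc1] := setD1P Nc.
  rewrite -cent_cycle; apply/trivgP.
  have <- : 'C_[~: V, <[c]>](<[c]>) = 1.
    apply: coprime_abel_cent_TI => //.
      by rewrite cycle_subG (subsetP nVN).
    exact: pnat_coprime pV (mem_p_elt p'N Nc1).
  by rewrite setSI ?sWc.
rewrite -defN; apply/eqP/commG1P; rewrite centsC cycle_subG.
exact: commg_cent_cyclic.
Qed.

(** Write c = [y, x] <> 1 in N.  As c centralises V, so does x.  An element h
of H that does not centralise V commutes with c, because [c, h] centralises V;
this applies to h and to h x, so c would commute with x. *)
Lemma CPPO_cent_of_cent (gT : finGroupType) (p : nat) (G V H N : {group gT})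
    (x : gT) :
    CPPO_group G -> V <| G -> p.-group V -> H \subset G -> p^'.-group H^`(1) ->
    N \subset H -> N :!=: 1 -> x \in H -> x \in 'N(N) -> 'C_N[x] = 1 ->
    V \subset 'C(N) ->
  H \subset 'C(V).
Proof.
move=> cG nsVG pV sHG p'H' sNH ntN Hx nNx cNx cVN.
have [c Nc ntc] := trivgPn _ ntN.
have [y Ny def_c] := commg_surj_fpf nNx cNx Nc.
have [Hy Hc] := (subsetP sNH y Ny, subsetP sNH c Nc).
have inH' g h : g \in H -> h \in H -> p^'.-elt [~ g, h].
  by move=> Hg Hh; apply: mem_p_elt p'H' _; rewrite mem_commg.
have nCG : G \subset 'N('C(V)) by rewrite norms_cent // normal_norm.
have star g h : g \in H -> h \in H ->
    [~ g, h] != 1 -> [~ g, h] \in 'C(V) -> h \in 'C(V).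
  move=> Hg Hh ntgh cVgh; apply/centP=> v Vv; apply/commute_sym/commgP.
  have [Gg Gh] := (subsetP sHG g Hg, subsetP sHG h Hh).
  have := CPPO_commg_sub cG nsVG pV Gg Gh (inH' g h Hg Hh) ntgh Vv.
  suffices /commG1P-> : V \subset 'C(<[ [~ g, h] ]>) by move/set1P->.
  by rewrite centsC cycle_subG.
have cVc : c \in 'C(V) by rewrite (subsetP _ c Nc) // centsC.
have cVx : x \in 'C(V) by apply: (star y); rewrite ?def_c.
have starc h : h \in H -> h \notin 'C(V) -> [~ c, h] = 1.
  move=> Hh; apply: contraNeq => ntch; apply: star ntch _ => //.
  rewrite commgEl groupM ?groupV // memJ_norm // (subsetP nCG) //.
  exact: (subsetP sHG).
apply/subsetP=> h Hh; apply: contraT => ncVh.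
have ch := starc h Hh ncVh.
have chx : [~ c, h * x] = 1.
  by apply: starc; [apply: groupM | rewrite groupMr].
have : c \in 'C_N[x].
  rewrite inE Nc; apply/cent1P/commgP; move: chx.
  by rewrite commgMJ ch conj1g mulg1 => ->.
by rewrite cNx => /set1P c1; rewrite c1 eqxx in ntc.
Qed.

(** * The derived subgroup of a soluble group *)

Theorem theorem1p1 (gT : finGroupType) (G : {group gT})
    (solG : solvable G) (cppoG : CPPO_group G) :
  size (primes #|G^`(1)|) <= 2.
Proof.
have [n] := ubnP #|G|; elim: n => // n IHn in gT G solG cppoG * => /ltnSE-leGn.
rewrite leqNgt; apply/negP=> gt2.
have ntG' : G^`(1)%G :!=: 1 by apply: contraTneq gt2 => /= ->; rewrite cards1.
have [V minV sVG'] := minnormal_exists ntG' (der_norm 1 G).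
have solG' : solvable G^`(1) := solvableS (der_sub 1 G) solG.
have [nVG ntV /is_abelemP[p p_pr abV]] := minnormal_solvable minV sVG' solG'.
have [pV cVV _] := and3P abV.
have sVG := subset_trans sVG' (der_sub 1 G).
have nsVG : V <| G by apply/andP.
have nVG' : G^`(1) \subset 'N(V) := subset_trans (der_sub 1 G) nVG.
have le2 : size (primes #|G^`(1) / V|) <= 2.
  rewrite quotient_der //; apply: IHn => //.
  - exact: quotient_sol.
  - exact: CPPO_quotient.
  by apply: leq_trans leGn; rewrite ltn_quotient.
have sub_pi : {subset primes #|G^`(1)| <= p :: primes #|G^`(1) / V|}.
  move=> s; rewrite inE !mem_primes !cardG_gt0 /= => /andP[s_pr].
  rewrite -(Lagrange sVG') -card_quotient // Euclid_dvdM // s_pr.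
  by case/orP=> [/(pgroupP pV s s_pr) | ->]; [rewrite inE => -> | rewrite orbT].
have p'Q : p \notin primes #|G^`(1) / V|.
  apply: contraL gt2 => pQ; rewrite -leqNgt (leq_trans _ le2) //.
  apply: uniq_leq_size (primes_uniq _) _ => s /sub_pi.
  by rewrite inE => /predU1P[-> |].
have [q [r def_qr]] : exists q r, primes #|G^`(1) / V| = [:: q; r].
  have := leq_trans gt2 (uniq_leq_size (primes_uniq _) sub_pi).
  by case: (primes _) le2 => [|q [|r []]] //= _ _; exists q, r.
have hallV : p.-Hall(G^`(1)) V.
  by rewrite /pHall sVG' pV -card_quotient //= p'natEpi.
have [K hallK] := Hall_exists p^' solG'.
have [sKG' p'K _] := and3P hallK.
pose H := 'N_G(K)%G; have sHG : H \subset G := subsetIl G _.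
have nVH := subset_trans sHG nVG.
have defG' : V * K = G^`(1).
  have nsVG' : V <| G^`(1) by apply/andP.
  exact: sdprodW (elimT (sdprod_normal_p'HallP nsVG' hallK) hallV).
have sKH : K \subset H by rewrite subsetI normG (subset_trans sKG') // der_sub.
have defG : V * H = G.
  have := Hall_Frattini_arg solG' (der_normal 1 G) hallK.
  by rewrite /= -defG' -mulgA mulSGid.
have nsVHG : V :&: H <| G.
  rewrite /normal subIset ?sVG //= -{1}defG mulG_subG; apply/andP; split.
    by apply: cents_norm; rewrite centsC (subset_trans _ cVV) ?subsetIl.
  by rewrite normsI ?normG.
(* V and K cannot both be normal in G. *)
have [VH1 | ntVH] := eqVneq (V :&: H) 1; last first.
  have eqVH : V :&: H = V.
    have [_ minV'] := mingroupP minV.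
    apply: (minV' (V :&: H)%G); rewrite ?subsetIl //.
    by rewrite ntVH normal_norm.
  have eqHG : H :=: G.
    by rewrite -defG mulSGid // -eqVH subsetIr.
  have nsKG : K <| G by rewrite /normal -{1}eqHG sKH -eqHG subsetIr.
  have := CPPO_der1_normal_Hall cppoG hallV hallK nsVG nsKG.
  case/orP=> [sG'V | sG'K].
    by move: def_qr; rewrite (quotientS1 sG'V) cards1.
  case/negP: ntV; have := pnat_coprime pV p'K; rewrite coprime_sym => coKV.
  by rewrite -subG1 -(coprime_TIg coKV) subsetI subxx (subset_trans sVG').
(* H is isomorphic to G / V. *)
have piH' : primes #|H^`(1)| = [:: q; r].
  rewrite -def_qr quotient_der // -defG quotientMidl -quotient_der //.
  have /card_isog-> // : H^`(1) \isog H^`(1) / V.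
  apply: quotient_isog; first by rewrite (subset_trans (der_sub 1 H)).
  by apply/trivgP; rewrite -VH1 setIS ?der_sub.
have p'H' : p^'.-group H^`(1).
  by rewrite p'groupEpi; rewrite def_qr -piH' in p'Q.
have cppoH := CPPO_groupS sHG cppoG.
have [s [a [b [Ha Hb s'x ncx]]]] :=
  CPPO_two_primes_action cppoH (solvableS sHG solG) piH'.
have nsQH : 'O_s(H^`(1)) <| H by apply: gFnormal_trans (der_normal 1 H).
have [N [sNQ nNa nNb abN [ntN defN]]] :=
  CPPO_abelian_subgroup cppoH nsQH (pcore_pgroup _ _) Ha Hb s'x ncx.
have sN := pgroupS sNQ (pcore_pgroup _ _).
have sNH' := subset_trans sNQ (pcore_sub _ _).
have p'N := pgroupS sNH' p'H'.
have sNH := subset_trans sNH' (der_sub 1 H).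
have [Ga Gb] := (subsetP sHG a Ha, subsetP sHG b Hb).
have sNG := subset_trans sNH sHG.
have cVN := CPPO_abelian_action cppoG nsVG abV sNG Ga Gb p'N abN ntN nNa nNb
  sN s'x defN.
have cNx : 'C_N[ [~ a, b] ] = 1.
  rewrite -cent_cycle -{1}defN; apply: coprime_abel_cent_TI => //.
    by rewrite cycle_subG groupR.
  exact: pnat_coprime sN s'x.
have cVH : H \subset 'C(V).
  apply: (CPPO_cent_of_cent cppoG nsVG pV sHG p'H' sNH ntN _ _ cNx cVN).
    by rewrite groupR.
  by rewrite groupR.
case/negP: ntV; rewrite -subG1 -VH1 subsetI subxx (subset_trans sVG') //.
apply: der1_min; first by rewrite -defG mulG_subG normG cents_norm // centsC.
by rewrite -defG quotientMidr quotient_abelian.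
Qed.
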